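(* Let $n\ge 1$ and $m\ge 1$ be integers, let $\Delta^n\subset\mathbb{C}^n$ be a ball centered at the origin, and let $\lambda\in\mathbb{C}$ be a primitive $m$-th root of unity. Let $f:\Delta^n\to\mathbb{C}^n$ be a holomorphic mapping of the form $$f(z)=\lambda z+o(|z|),\quad z\in\Delta^n .$$ Then, in a neighborhood of the origin, the $m$-th iterate $f^m$ of $f$ satisfies $$f^m(z)=z+o(|z|^m).$$
   Context: Here $z=(z_1,\dots,z_n)\in\mathbb{C}^n$. For a positive integer $k$, the expression $o(|z|^k)$ in a formula for a holomorphic mapping into $\mathbb{C}^n$ near the origin denotes a mapping each of whose components is a (convergent) power series in $z_1,\dots,z_n$ consisting only of terms of total degree $>k$. In particular $f(z)=\lambda z+o(|z|)$ means $f(0)=0$ and the Jacobian matrix of $f$ at $0$ is $\lambda I$, and the conclusion means that each component of $f^m(z)-z$ has a power series expansion at the origin with only terms of degree $>m$. The iterates are defined by composition: $f^1=f$ and $f^k=f\circ f^{k-1}$ for $k\ge 2$; since $f(0)=0$, each $f^k$ is a well-defined holomorphic mapping in some neighborhood of the origin. A number $\lambda$ is a primitive $m$-th root of unity if $\lambda^m=1$ and $\lambda^j\ne 1$ for every positive integer $j<m$. *)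

(* Defs.v *)
From mathcomp Require Import all_boot all_order all_algebra finmap complex.
From mathcomp Require Import all_classical all_reals topology normedtype derive.
From mathcomp Require Import summability.

Set Implicit Arguments.
Unset Strict Implicit.
Unset Printing Implicit Defensive.

Import Order.TTheory GRing.Theory Num.Theory.
Import numFieldNormedType.Exports.

Local Open Scope classical_set_scope.
Local Open Scope ring_scope.

(* The alias keeps [numFieldType] as the head structure, which is what the
   canonical topology of [numFieldNormedType] is keyed on. *)
Definition Cplx (R : realType) : numFieldType := R[i].

Section PowerSeries.
Variables (R : realType) (n : nat).
Local Notation C := (Cplx R).
Implicit Types (z p : 'rV[C]_n) (c : {ffun 'I_n -> nat} -> C).

Definition total_degree (al : {ffun 'I_n -> nat}) : nat := (\sum_(i < n) al i)%N.

Definition monomial (al : {ffun 'I_n -> nat}) z : C :=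
  \prod_(i < n) z 0 i ^+ al i.

(* The multiple series is summed unconditionally (limit of the net of its finite
   partial sums), which over the complex numbers is absolute convergence. *)
Definition has_power_series p c (g : 'rV[C]_n -> C) : Prop :=
  \forall z \near p,
    partial_sum (fun al => c al * monomial al (z - p)) @ totally --> g z.

(* [differentiable] is taken over the scalar field [C], i.e. Frechet
   differentiability with a complex-linear differential; [D] is meant to be
   open, so that values of [F] outside [D] are irrelevant. *)
Definition holomorphic (D : set 'rV[C]_n) (F : 'rV[C]_n -> 'rV[C]_n) : Prop :=
  forall p, D p -> differentiable F p.

(* [F(z) = o(|z|^k)], in the sense that the expansion of each component of [F]
   at the origin only has terms of total degree [> k]. *)
Definition is_o_norm_pow (k : nat) (F : 'rV[C]_n -> 'rV[C]_n) : Prop :=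
  forall i : 'I_n, exists c,
    (forall al, (total_degree al <= k)%N -> c al = 0) /\
    has_power_series 0 c (fun z => F z 0 i).

(* The Euclidean ball: the library's [ball 0 r] on row vectors is a polydisc. *)
Definition eball (r : R) : set 'rV[C]_n :=
  [set z | \sum_(i < n) `|z 0 i| ^+ 2 < (r ^+ 2)%:C%C].

End PowerSeries.

(* Main.v *)
Require Import Defs.
From mathcomp Require Import all_boot all_order all_algebra finmap complex.
From mathcomp Require Import all_classical all_reals topology normedtype derive.
From mathcomp Require Import summability.
From mathcomp Require Import ring lra.

Import Order.TTheory GRing.Theory Num.Theory.
Import numFieldNormedType.Exports.
Local Open Scope classical_set_scope.
Local Open Scope ring_scope.

(* Put [F = f^m] and [G = F - id]; the components of [G] are convergent power
   series, because power series can be composed, and [G = O(|z|^2)].  Suppose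
   that [G] has no term of degree [< d], with [2 <= d <= m].  Since [f] and [F]
   commute and [f] is tangent to [lambda z],
     [lambda G(z) - G(lambda z) = O(|z|^(d+1))],
   so every coefficient of degree [d] of [G] is killed by [lambda - lambda^d].
   This factor is nonzero, as [lambda] is a primitive [m]-th root of unity and
   [1 <= d - 1 < m].  Hence [G] has no term of degree [d] either. *)

#[local] Existing Instance totally_filter.

(** * Unconditional sums *)

Section UnconditionalSums.
Set Implicit Arguments.
Unset Strict Implicit.
Unset Printing Implicit Defensive.
Variable K : numFieldType.

(** Coefficients of composites are never computed. A series is recorded by a bound on the sum of
    |c_al| rho^|al|; this bound is submultiplicative, so composition becomes a rearrangement of an
    absolutely summable family. Information on coefficients is then recovered from growth alone: a
    series without terms of degree < d that is O(|z|^(d+1)) has no terms of degree d, because its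
    homogeneous part of degree d scales like s^d. The estimate drawn from commutation rests on an
    identity. With h(z) = f(z) - lambda z, the equation f(F(z)) = F(f(z)) reads lambda G(z) -
    G(lambda z) = (h(z) - h(F(z))) + (G(f(z)) - G(lambda z)), and both differences are controlled by
    Lipschitz bounds near the origin. Degree 1 is resonant (lambda - lambda^1 = 0), which is why the
    induction can only start once lambda^m = 1 has removed the linear part of G. *)

Definition has_sum (I : choiceType) (x : I -> K) (s : K) : Prop :=
  partial_sum x @ totally --> s.

(** Bounding all finite sums of norms allows absolute convergence to be used before any limit is
    known to exist. Over the complex numbers the inequality also forces [M] to be real and
    nonnegative. *)
Definition abs_bounded (I : choiceType) (x : I -> K) (M : K) : Prop :=
  forall A : {fset I}, \sum_(i <- A) `|x i| <= M.

Lemma partial_sumE (I : choiceType) (x : I -> K) :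
  partial_sum x = fun A : {fset I} => \sum_(i <- A) x i.
Proof. by apply/funext => A; rewrite big_seq_fsetE. Qed.

Lemma has_sumP (I : choiceType) (x : I -> K) (s : K) :
  has_sum x s <-> forall e, 0 < e -> exists A : {fset I},
    forall B : {fset I}, (A `<=` B)%fset -> `|\sum_(i <- B) x i - s| < e.
Proof.
rewrite /has_sum partial_sumE; split.
  move=> /cvgrPdist_lt h e /h [A _ hA]; exists A => B /hA /=.
  by rewrite distrC.
move=> h; apply/cvgrPdist_lt => e /h [A hA]; exists A => // B /= /hA.
by rewrite distrC.
Qed.

Lemma norm_limit_le (T : Type) (F : set_system T) (FF : ProperFilter F)
    (u : T -> K) (l M : K) :
  u @ F --> l -> (\forall t \near F, `|u t| <= M) -> `|l| <= M.
Proof.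
move=> /cvgrPdist_lt ul uM; apply/ler_addgt0Pr => e e0.
near F => t.
have h1 : `|l - u t| < e by near: t; exact: ul.
have h2 : `|u t| <= M by near: t.
by rewrite -[l](subrK (u t)) (le_trans (ler_normD _ _))// addrC lerD// ltW.
Unshelve. all: by end_near. Qed.

Lemma has_sum_unique (I : choiceType) (x : I -> K) (s t : K) :
  has_sum x s -> has_sum x t -> s = t.
Proof. by move=> h1 h2; apply: (@cvg_unique K _ _ _ s t h1 h2). Qed.

Lemma has_sum_norm_le (I : choiceType) (x : I -> K) (s M : K) :
  abs_bounded x M -> has_sum x s -> `|s| <= M.
Proof.
move=> xM xs; apply: (@norm_limit_le _ totally _ _ _ _ xs); near=> A.
by rewrite partial_sumE (le_trans (ler_norm_sum _ _ _)).
Unshelve. all: by end_near. Qed.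

Lemma has_sumZ (I : choiceType) (x : I -> K) (k s : K) :
  has_sum x s -> has_sum (fun i => k * x i) (k * s).
Proof.
move=> xs; rewrite /has_sum (_ : partial_sum _ = fun A => k * partial_sum x A).
  exact: cvgMl_tmp.
by apply/funext => A; rewrite /partial_sum mulr_sumr.
Qed.

Lemma has_sumD (I : choiceType) (x y : I -> K) (s t : K) :
  has_sum x s -> has_sum y t -> has_sum (fun i => x i + y i) (s + t).
Proof.
move=> xs yt; rewrite /has_sum.
rewrite (_ : partial_sum _ = partial_sum x \+ partial_sum y).
  exact: cvgD.
by apply/funext => A; rewrite /partial_sum/= big_split.
Qed.

Lemma has_sum_finite (I : choiceType) (x : I -> K) (A : {fset I}) :
  (forall i, i \notin A -> x i = 0) -> has_sum x (\sum_(i <- A) x i).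
Proof.
move=> x0; apply/has_sumP => e e0; exists A => B AB.
rewrite -(big_fset_incl _ AB) ?subrr ?normr0// => i _; exact: x0.
Qed.

Lemma has_sum_single (I : choiceType) (x : I -> K) (i0 : I) :
  (forall i, i != i0 -> x i = 0) -> has_sum x (x i0).
Proof.
move=> x0; have := @has_sum_finite I x [fset i0]%fset.
by rewrite big_seq_fset1; apply=> i; rewrite inE; exact: x0.
Qed.

Lemma has_sum_bij (I J : choiceType) (x : I -> K) (h : J -> I) (g : I -> J) s :
  cancel h g -> cancel g h -> has_sum x s -> has_sum (x \o h) s.
Proof.
move=> hg gh /has_sumP xs; apply/has_sumP => e /xs[A hA].
exists (g @` A)%fset => B gAB.
have -> : \sum_(j <- B) (x \o h) j = \sum_(i <- (h @` B)%fset) x i.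
  by rewrite big_imfset//= => i j _ _; exact: (can_inj hg).
apply: hA; apply/fsubsetP => i iA; apply/imfsetP; exists (g i); rewrite ?gh//=.
by apply: (fsubsetP gAB); apply/imfsetP; exists i.
Qed.

Lemma abs_bounded_ge0 (I : choiceType) (x : I -> K) M : abs_bounded x M -> 0 <= M.
Proof. by move=> /(_ fset0); rewrite big_seq_fset0. Qed.

Lemma abs_bounded_le (I : choiceType) (x y : I -> K) (M N : K) :
  (forall i, `|y i| <= `|x i|) -> M <= N -> abs_bounded x M -> abs_bounded y N.
Proof.
by move=> yx MN xM A; apply: le_trans MN; apply: le_trans (xM A); apply: ler_sum.
Qed.

Lemma abs_bounded_single (I : choiceType) (x : I -> K) i0 M :
  (forall i, i != i0 -> x i = 0) -> `|x i0| <= M -> abs_bounded x M.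
Proof.
move=> x0 xM A; apply: le_trans xM; have [iA|iA] := boolP (i0 \in A).
  rewrite (big_fsetD1 i0)//= big1_fset ?addr0// => i; rewrite !inE => /andP[ne _] _.
  by rewrite x0// normr0.
rewrite big1_fset// => i iA' _; rewrite x0 ?normr0//.
by apply: contraNneq iA => <-.
Qed.

Lemma sum_fset_le (I : choiceType) (A B : {fset I}) (x : I -> K) :
  (forall i, 0 <= x i) -> (A `<=` B)%fset ->
  \sum_(i <- A) x i <= \sum_(i <- B) x i.
Proof.
move=> x0 AB; rewrite [leRHS](big_fsetID _ (mem A))/=.
have -> : [fset i | i in B & i \in A]%fset = A.
  apply/fsetP => i; rewrite !inE/=; apply/andP/idP => [[]//|iA].
  by split=> //; exact: (fsubsetP AB).
by rewrite lerDl sumr_ge0.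
Qed.

Lemma sum_fsetM (I J : choiceType) (A : {fset I}) (B : {fset J}) (x : I * J -> K) :
  \sum_(p <- (A `*` B)%fset) x p = \sum_(i <- A) \sum_(j <- B) x (i, j).
Proof.
rewrite /fsetM big_imfset2//= => -[i j] [i' j'] _ _ /= [-> ->] //.
Qed.

Lemma fsubset_fstsnd (I J : choiceType) (A : {fset I * J}) :
  (A `<=` [fset p.1 | p in A] `*` [fset p.2 | p in A])%fset.
Proof.
apply/fsubsetP => p pA; rewrite in_fsetM; apply/andP.
by split; apply/imfsetP; exists p.
Qed.

(** Every finite set of pairs lies in a finite rectangle, and a rectangle can be summed row by
    row. *)
Lemma abs_bounded_pair (I J : choiceType) (x : I * J -> K) (m : I -> K) (M : K) :
  (forall i, abs_bounded (fun j => x (i, j)) (m i)) -> abs_bounded m M ->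
  abs_bounded x M.
Proof.
move=> xm mM A; apply: le_trans (mM [fset p.1 | p in A]%fset).
apply: le_trans (sum_fset_le _ (fsubset_fstsnd A)) _ => //.
rewrite sum_fsetM; apply: ler_sum => i _.
by rewrite (ger0_norm (abs_bounded_ge0 (xm i))); exact: xm.
Qed.

Lemma abs_bounded_swap (I J : choiceType) (x : I * J -> K) M :
  abs_bounded (fun p : J * I => x (p.2, p.1)) M -> abs_bounded x M.
Proof.
move=> xM A; apply: le_trans (xM [fset (p.2, p.1) | p in A]%fset).
rewrite big_imfset//=; last by move=> [a b] [c d] _ _ [-> ->].
by apply: ler_sum => -[i j].
Qed.

(** Fubini in the direction that needs no absolute bound: once [B] contains the first projections of
    [A], the rectangles over [B] and a large [C] contain [A], and [C] can go to its limit with [B]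
    fixed. *)
Lemma has_sum_rows (I J : choiceType) (x : I * J -> K) (s : I -> K) (S : K) :
  has_sum x S -> (forall i, has_sum (fun j => x (i, j)) (s i)) -> has_sum s S.
Proof.
move=> /has_sumP xS xs; apply/has_sumP => e e0.
have [A hA] := xS _ (divr_gt0 e0 (ltr0n _ 2)).
exists [fset p.1 | p in A]%fset => B AB.
(* The limit in [C] preserves only weak inequalities, hence the margin [e / 2]. *)
suff : `|\sum_(i <- B) s i - S| <= e / 2.
  by move=> /le_lt_trans; apply; rewrite gtr_pMr// invf_lt1// ltr1n.
pose u (C : {fset J}) := \sum_(i <- B) partial_sum (fun j => x (i, j)) C - S.
apply: (@norm_limit_le _ totally _ u).
  apply: cvgB; last exact: cvg_cst.
  by apply: cvg_big => [|i _]; [exact: add_continuous | exact: xs].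
exists [fset p.2 | p in A]%fset => //= C AC.
rewrite /u; under eq_bigr do rewrite partial_sumE.
rewrite -sum_fsetM ltW// hA//.
apply: fsubset_trans (fsubset_fstsnd A) _.
by apply/fsubsetP => p; rewrite !in_fsetM => /andP[/(fsubsetP AB)-> /(fsubsetP AC)->].
Qed.

Lemma has_sum_cols (I J : choiceType) (x : I * J -> K) (t : J -> K) (S : K) :
  has_sum x S -> (forall j, has_sum (fun i => x (i, j)) (t j)) -> has_sum t S.
Proof.
move=> xS; apply: (@has_sum_rows J I (x \o (fun p => (p.2, p.1)))).
by apply: (has_sum_bij (g := fun p => (p.2, p.1))) xS => -[].
Qed.

Lemma abs_bounded_rows (I J : choiceType) (x : I * J -> K) (s : I -> K) (M : K) :
  abs_bounded x M -> (forall i, has_sum (fun j => x (i, j)) (s i)) ->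
  abs_bounded s M.
Proof.
move=> xM xs A.
have -> : \sum_(i <- A) `|s i| = `| \sum_(i <- A) `|s i| |.
  by rewrite ger0_norm// sumr_ge0.
apply: (@norm_limit_le _ totally _
  (fun C => \sum_(i <- A) `|partial_sum (fun j => x (i, j)) C|)).
  apply: cvg_big => [|i _]; [exact: add_continuous | exact: cvg_norm (xs i)].
near=> C; rewrite ger0_norm ?sumr_ge0//.
apply: le_trans (xM (A `*` C)%fset); rewrite sum_fsetM.
by apply: ler_sum => i _; rewrite partial_sumE ler_norm_sum.
Unshelve. all: by end_near. Qed.

End UnconditionalSums.

(** * Real families: unconditional and absolute summability agree *)

Section RealSums.
Set Implicit Arguments.
Unset Strict Implicit.
Unset Printing Implicit Defensive.
Variables (R : realType) (I : choiceType).
Implicit Types (r : I -> R) (M s : R).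

Lemma has_sum_nneg r M : (forall i, 0 <= r i) ->
  (forall A : {fset I}, \sum_(i <- A) r i <= M) -> exists s, has_sum r s.
Proof.
move=> r0 rM; pose E := [set t | exists A : {fset I}, t = \sum_(i <- A) r i].
have supE : has_sup E.
  split; first by exists (\sum_(i <- fset0) r i), fset0.
  by exists M => _ [A ->].
exists (sup E); apply/has_sumP => e e0.
have [_ [A ->] hA] := sup_adherent e0 supE.
exists A => B AB; have : \sum_(i <- B) r i <= sup E.
  by apply: (ub_le_sup supE.2); exists B.
have := sum_fset_le r0 AB; move: hA; set a := \sum_(i <- A) _.
by set b := \sum_(i <- B) _ => *; rewrite ltr_norml; lra.
Qed.

Lemma abs_bounded_has_sum_real r M : abs_bounded r M -> exists s, has_sum r s.
Proof.
move=> rM; have [i|i|s hs] := @has_sum_nneg (fun i => `|r i|) M; first by [].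
  exact: rM.
have [i|A|t ht] := @has_sum_nneg (fun i => r i + `|r i|) (M + M).
- by have := ler_norm (- r i); rewrite normrN; lra.
- rewrite big_split/= lerD ?rM//.
  by apply: le_trans (ler_norm _) _; apply: le_trans (ler_norm_sum _ _ _) _; exact: rM.
exists (t + -1 * s); have := has_sumD ht (has_sumZ (k := -1) hs).
by congr (has_sum _ _); apply/funext => i; ring.
Qed.

(** Cauchy criterion: a finite [D] disjoint from [A] has a sum of absolute value at most 2, since
    the sums over [A] and over its union with [D] are both within 1 of [s]. Outside [A], each sign
    class contributes at most 2 to the sum of absolute values, hence the 4. *)
Lemma has_sum_abs_bounded_real r s : has_sum r s -> exists M, abs_bounded r M.
Proof.
move=> /has_sumP /(_ 1 ltr01)[A hA]; exists (\sum_(i <- A) `|r i| + 4) => B.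
have h D : [disjoint A & D]%fset -> `|\sum_(i <- D) r i| <= 2.
  move=> AD; have hAD : \sum_(i <- (A `|` D)%fset) r i =
      \sum_(i <- A) r i + \sum_(i <- D) r i.
    rewrite (big_fsetID _ (mem A))/=; congr (_ + _); apply: eq_fbigl => i.
      by rewrite !inE/= andbC; case: (i \in A).
    rewrite !inE/= andbC; case: (boolP (i \in A)) => //= iA.
    by apply/esym/negbTE; apply: (fdisjointP AD).
  have := hA _ (fsubset_refl A); have := hA _ (fsubsetUl A D); rewrite hAD.
  by rewrite !ltr_norml ler_norml; lra.
rewrite (big_fsetID _ (mem A))/= lerD//.
  by apply: sum_fset_le => //; apply/fsubsetP => i; rewrite !inE => /andP[].
rewrite (big_fsetID _ (fun i => 0 <= r i))/=.
set D1 := [fset i | i in _ & _]%fset; set D2 := [fset i | i in _ & _]%fset.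
have -> : \sum_(i <- D1) `|r i| = \sum_(i <- D1) r i.
  by apply: eq_fbigr => i; rewrite !inE => /andP[_ ri] _; rewrite ger0_norm.
have -> : \sum_(i <- D2) `|r i| = - \sum_(i <- D2) r i.
  rewrite -sumrN; apply: eq_fbigr => i; rewrite !inE -ltNge => /andP[_ ri] _.
  by rewrite ltr0_norm.
have /h : [disjoint A & D1]%fset.
  by apply/fdisjointP => i iA; rewrite !inE/= iA/= andbF.
have /h : [disjoint A & D2]%fset.
  by apply/fdisjointP => i iA; rewrite !inE/= iA/= andbF.
by rewrite !ler_norml; lra.
Qed.

End RealSums.

(** * Complex families, through real and imaginary parts *)

Section ComplexSums.
Set Implicit Arguments.
Unset Strict Implicit.
Unset Printing Implicit Defensive.
Variable R : realType.
Local Notation C := (Cplx R).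

Lemma complex_norm_le (z : R[i]) :
  `|z| <= (`|complex.Re z| + `|complex.Im z|)%:C%C.
Proof.
rewrite {1}[z]complexE (le_trans (ler_normD _ _))//.
rewrite normrM !normc_def/= !expr0n/= !addr0 !add0r !expr1n !sqrtr_sqr !sqrtr1.
by rewrite mul1r -rmorphD.
Qed.

Lemma normc_ge_Im (z : R[i]) : `|complex.Im z|%:C%C <= `|z|.
Proof.
rewrite normc_def lecE/= eqxx/= -sqrtr_sqr ler_wsqrtr// lerDr.
exact: sqr_ge0.
Qed.

Lemma complex_sumE (I : choiceType) (x : I -> R[i]) (A : {fset I}) :
  \sum_(i <- A) x i =
  ((\sum_(i <- A) complex.Re (x i)) +i* (\sum_(i <- A) complex.Im (x i)))%C.
Proof.
apply: (big_ind3 (fun a b c => a = (b +i* c)%C)) => //.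
  by move=> ? a b ? c d -> ->.
by move=> i _; case: (x i).
Qed.

Lemma has_sum_complex (I : choiceType) (x : I -> C) (a b : R) :
  has_sum (fun i => complex.Re (x i)) a -> has_sum (fun i => complex.Im (x i)) b ->
  has_sum x ((a +i* b)%C : C).
Proof.
move=> /has_sumP ha /has_sumP hb; apply/has_sumP => e.
rewrite ltcE/= => /andP[/eqP ei er].
have [A hA] := ha _ (divr_gt0 er (ltr0n _ 2)).
have [B hB] := hb _ (divr_gt0 er (ltr0n _ 2)).
exists (A `|` B)%fset => D ABD; have {hA} := hA D (fsubset_trans (fsubsetUl _ _) ABD).
have {hB} := hB D (fsubset_trans (fsubsetUr _ _) ABD).
rewrite (complex_sumE x) => h1 h2; apply: le_lt_trans (complex_norm_le _) _.
by rewrite ltcE/= ei eqxx/= [ltRHS](splitr (complex.Re e)) addrC ltrD.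
Qed.

Lemma has_sum_complex_parts (I : choiceType) (x : I -> C) (s : C) :
  has_sum x s -> has_sum (fun i => complex.Re (x i)) (complex.Re s) /\
  has_sum (fun i => complex.Im (x i)) (complex.Im s).
Proof.
move=> /has_sumP xs; split; apply/has_sumP => e e0.
  have [|A hA] := xs (e%:C%C : R[i]); first by rewrite ltcE/= eqxx.
  exists A => B /hA; rewrite (complex_sumE x) => h.
  by have := le_lt_trans (normc_ge_Re _) h; rewrite ltcE/= eqxx/=; case: (s).
have [|A hA] := xs (e%:C%C : R[i]); first by rewrite ltcE/= eqxx.
exists A => B /hA; rewrite (complex_sumE x) => h.
have := le_lt_trans (normc_ge_Im _) h; rewrite ltcE/= eqxx/=; case: (s) => //.
Qed.

Lemma abs_bounded_has_sum (I : choiceType) (x : I -> C) (M : C) :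
  abs_bounded x M -> exists s, has_sum x s.
Proof.
move=> xM.
have hre (u : I -> R) : (forall i, (`|u i|%:C%C : R[i]) <= `|x i|) ->
    abs_bounded u (complex.Re M).
  move=> ux A; suff : ((\sum_(i <- A) `|u i|)%:C%C : R[i]) <= M.
    by rewrite lecE => /andP[].
  by rewrite rmorph_sum/=; apply: le_trans (xM A); apply: ler_sum.
have [a ha] := abs_bounded_has_sum_real (hre _ (fun i => normc_ge_Re (x i))).
have [b hb] := abs_bounded_has_sum_real (hre _ (fun i => normc_ge_Im (x i))).
by exists ((a +i* b)%C); exact: has_sum_complex.
Qed.

(** Turns the unconditional convergence in [has_power_series] into the absolute bounds on which the
    rearrangements rest. *)
Lemma has_sum_abs_bounded (I : choiceType) (x : I -> C) (s : C) :
  has_sum x s -> exists M, abs_bounded x M.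
Proof.
move=> /has_sum_complex_parts[/has_sum_abs_bounded_real[M hM]].
move=> /has_sum_abs_bounded_real[N hN]; exists (((M + N)%:C)%C : R[i]) => A.
apply: le_trans (ler_sum _ (fun i _ => complex_norm_le (x i))) _.
rewrite -rmorph_sum/= lecE/= eqxx big_split/= lerD//.
Qed.

(** Fubini in the other direction: the absolute bound gives the whole family some sum, which
    [has_sum_rows] and uniqueness identify with [S]. *)
Lemma has_sum_pair (I J : choiceType) (x : I * J -> C) (s : I -> C) (M S : C) :
  abs_bounded x M -> (forall i, has_sum (fun j => x (i, j)) (s i)) ->
  has_sum s S -> has_sum x S.
Proof.
move=> /abs_bounded_has_sum[T xT] xs sS.
by rewrite (has_sum_unique sS (has_sum_rows xT xs)).
Qed.

End ComplexSums.

(** * Power series on polydiscs *)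

Section PowerSeriesCalculus.
Set Implicit Arguments.
Unset Strict Implicit.
Unset Printing Implicit Defensive.
Variables (R : realType) (n : nat).
Local Notation C := (Cplx R).
Local Notation midx := {ffun 'I_n -> nat}.
Implicit Types (al be : midx) (z : 'rV[C]_n) (c : midx -> C) (rho M : C).

Definition midx_add al be : midx := [ffun i => (al i + be i)%N].

Lemma total_degree_add al be :
  total_degree (midx_add al be) = (total_degree al + total_degree be)%N.
Proof. by rewrite /total_degree -big_split; apply: eq_bigr => i _; rewrite ffunE. Qed.

Lemma monomial_add al be z :
  monomial (midx_add al be) z = monomial al z * monomial be z.
Proof. by rewrite /monomial -big_split; apply: eq_bigr => i _; rewrite ffunE exprD. Qed.

Lemma norm_monomial_le al z rho : (forall i, `|z 0 i| <= rho) ->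
  `|monomial al z| <= rho ^+ total_degree al.
Proof.
move=> zr; rewrite /monomial /total_degree normr_prod -prodrXr.
by apply: ler_prod => i _; rewrite normrX exprn_ge0//= lerXn2r// ?nnegrE// (le_trans _ (zr i)).
Qed.

Lemma monomial_const al rho : monomial al (const_mx rho) = rho ^+ total_degree al.
Proof. by rewrite /monomial -prodrXr; apply: eq_bigr => i _; rewrite mxE. Qed.

Lemma monomialZ al k z : monomial al (k *: z) = k ^+ total_degree al * monomial al z.
Proof.
rewrite /monomial /total_degree -prodrXr -big_split; apply: eq_bigr => i _ /=.
by rewrite mxE exprMn.
Qed.

(** [M] bounds a weighted l^1 norm of the coefficients. This norm dominates [F] on the closed
    polydisc and is submultiplicative. *)
Definition power_series_on rho M c (F : 'rV[C]_n -> C) : Prop :=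
  abs_bounded (fun al => c al * rho ^+ total_degree al) M /\
  forall z, (forall i, `|z 0 i| <= rho) -> has_sum (fun al => c al * monomial al z) (F z).

Lemma power_series_on_ext rho M c (F G : 'rV[C]_n -> C) :
  (forall z, (forall i, `|z 0 i| <= rho) -> F z = G z) ->
  power_series_on rho M c F -> power_series_on rho M c G.
Proof.
move=> FG [b s]; split; first exact: b.
by move=> z zr; rewrite -(FG z zr); exact: s.
Qed.

(* The coefficient at [al] of the regrouped series collects the terms of
   multidegree [al]; it exists since the double family indexed by a term and a
   multi-index is absolutely summable. *)
Lemma power_series_regroup (K : choiceType) (a : K -> C) (d : K -> midx) F rho M :
  0 < rho -> abs_bounded (fun k => a k * rho ^+ total_degree (d k)) M ->
  (forall z, (forall i, `|z 0 i| <= rho) ->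
     has_sum (fun k => a k * monomial (d k) z) (F z)) ->
  exists c, power_series_on rho M c F.
Proof.
move=> rho0 aM aF.
have /choice[c hc] : forall al, exists s,
    has_sum (fun k => if d k == al then a k else 0) s.
  move=> al; apply: (@abs_bounded_has_sum _ _ _ (M / rho ^+ total_degree al)) => A.
  rewrite ler_pdivlMr ?exprn_gt0// mulr_suml; apply: le_trans (aM A).
  apply: ler_sum => k _; case: eqP => [<-|_]; last by rewrite normr0 mul0r.
  by rewrite normrM normrX (gtr0_norm rho0).
(* The array is supported on the graph of [d]: summed by columns it is the given series, summed by
   rows the regrouped one. *)
pose x z (p : midx * K) := if d p.2 == p.1 then a p.2 * monomial p.1 z else 0.
have xM z : (forall i, `|z 0 i| <= rho) -> abs_bounded (x z) M.
  move=> zr; apply: abs_bounded_swap.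
  apply: (@abs_bounded_pair _ _ _ _ (fun k => `|a k * rho ^+ total_degree (d k)|)).
    move=> k; apply: (abs_bounded_single (i0 := d k)); last first.
      rewrite /x/= eqxx !normrM ler_wpM2l// normrX (gtr0_norm rho0).
      exact: norm_monomial_le.
    by move=> al ne; rewrite /x/= eq_sym (negbTE ne).
  by apply: abs_bounded_le aM => // k; rewrite normr_id.
have xrow z al : has_sum (fun k => x z (al, k)) (c al * monomial al z).
  rewrite mulrC; have := has_sumZ (k := monomial al z) (hc al).
  congr (has_sum _ _); apply/funext => k; rewrite /x/=.
  by case: eqP => _; rewrite ?mulr0// mulrC.
have xF z : (forall i, `|z 0 i| <= rho) -> has_sum (x z) (F z).
  move=> zr.
  have [S xS] := abs_bounded_has_sum (xM z zr).
  suff tS : has_sum (fun k => a k * monomial (d k) z) S.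
    by rewrite (has_sum_unique (aF z zr) tS).
  apply: (has_sum_cols xS) => k.
  rewrite [X in has_sum _ X](_ : _ = x z (d k, k)); last by rewrite /x/= eqxx.
  apply: (@has_sum_single _ _ (fun al => x z (al, k))) => al ne.
  by rewrite /x/= eq_sym (negbTE ne).
have rhoz i : `|(const_mx rho : 'rV[C]_n) 0 i| <= rho by rewrite mxE gtr0_norm.
exists c; split => [|z zr]; last exact: (has_sum_rows (xF z zr) (xrow z)).
(* At the corner of the polydisc the monomials equal [rho ^+ total_degree al], so the bound on the
   row sums is the bound required of [c]. *)
have := abs_bounded_rows (xM _ rhoz) (xrow (const_mx rho)).
by congr (abs_bounded _ _); apply/funext => al; rewrite monomial_const.
Qed.

Lemma power_series_on_sum (J : choiceType) (c : J -> midx -> C) (m : J -> C)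
    (F : J -> 'rV[C]_n -> C) G rho M :
  0 < rho -> (forall j, power_series_on rho (m j) (c j) (F j)) ->
  abs_bounded m M ->
  (forall z, (forall i, `|z 0 i| <= rho) -> has_sum (fun j => F j z) (G z)) ->
  exists c', power_series_on rho M c' G.
Proof.
move=> rho0 cF mM FG.
pose a (p : J * midx) := c p.1 p.2.
have aM : abs_bounded (fun p => a p * rho ^+ total_degree p.2) M.
  by apply: abs_bounded_pair mM => j; exact: (cF j).1.
apply: (power_series_regroup rho0 aM) => z zr.
apply: (@has_sum_pair _ _ _ _ (fun j => F j z) M) => [|j|].
- apply: abs_bounded_le aM => // -[j al]; rewrite !normrM ler_wpM2l//.
  by rewrite normrX (gtr0_norm rho0) norm_monomial_le.
- exact: (cF j).2.
- exact: FG.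
Qed.

Lemma power_series_on_mul c1 c2 F1 F2 rho M1 M2 :
  0 < rho -> power_series_on rho M1 c1 F1 -> power_series_on rho M2 c2 F2 ->
  exists c, power_series_on rho (M1 * M2) c (fun z => F1 z * F2 z).
Proof.
move=> rho0 [b1 s1] [b2 s2].
have M20 := abs_bounded_ge0 b2.
pose a (p : midx * midx) := c1 p.1 * c2 p.2.
have aM : abs_bounded (fun p => a p * rho ^+ total_degree (midx_add p.1 p.2)) (M1 * M2).
  pose m al := `|c1 al * rho ^+ total_degree al| * M2.
  apply: (@abs_bounded_pair _ _ _ _ m) => [al A|A].
    apply: le_trans (ler_wpM2l (normr_ge0 _) (b2 A)); rewrite mulr_sumr.
    apply: ler_sum => be _; rewrite -normrM total_degree_add exprD /a/=.
    by rewrite mulrACA.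
  apply: le_trans (ler_wpM2r M20 (b1 A)); rewrite mulr_suml.
  by apply: ler_sum => al _; rewrite normrM normr_id (ger0_norm M20).
apply: (power_series_regroup rho0 aM) => z zr.
apply: (@has_sum_pair _ _ _ _ (fun al => c1 al * monomial al z * F2 z) (M1 * M2)) => [|al|].
- apply: abs_bounded_le aM => // -[al be]; rewrite normrM [leRHS]normrM ler_wpM2l//.
  by rewrite normrX (gtr0_norm rho0) norm_monomial_le.
- have := has_sumZ (k := c1 al * monomial al z) (s2 z zr).
  congr (has_sum _ _); apply/funext => be; rewrite /a/= monomial_add; ring.
- rewrite mulrC; have := has_sumZ (k := F2 z) (s1 z zr).
  by congr (has_sum _ _); apply/funext => al; rewrite mulrC.
Qed.

Lemma power_series_on_cst k rho M : `|k| <= M -> exists c, power_series_on rho M c (fun=> k).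
Proof.
move=> kM; pose o : midx := [ffun=> 0%N].
have dego : total_degree o = 0%N by rewrite /total_degree big1// => i _; rewrite ffunE.
exists (fun al => if al == o then k else 0); split.
  apply: (abs_bounded_single (i0 := o)) => [al /negbTE->|]; first by rewrite mul0r.
  by rewrite eqxx dego mulr1.
move=> z _; have := @has_sum_single _ _
  (fun al => (if al == o then k else 0) * monomial al z) o.
rewrite eqxx /monomial big1 ?mulr1 => [|i _]; last by rewrite ffunE expr0.
by apply=> al /negbTE->; rewrite mul0r.
Qed.

Lemma power_series_on_exp c F rho M k : 0 < rho -> power_series_on rho M c F ->
  exists c', power_series_on rho (M ^+ k) c' (fun z => F z ^+ k).
Proof.
move=> rho0 cF; elim: k => [|k [c' IH]].
  by apply: power_series_on_cst; rewrite normr1 expr0.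
have [c'' h] := power_series_on_mul rho0 cF IH.
by exists c''; rewrite exprS; apply: power_series_on_ext h => z _; rewrite exprS.
Qed.

Lemma power_series_on_prod (s : seq 'I_n) (c : 'I_n -> midx -> C)
    (F : 'I_n -> 'rV[C]_n -> C) rho M be :
  0 < rho -> (forall i, power_series_on rho M (c i) (F i)) ->
  exists c', power_series_on rho (\prod_(i <- s) M ^+ be i) c'
    (fun z => \prod_(i <- s) F i z ^+ be i).
Proof.
move=> rho0 cF; elim: s => [|i s [c1 IH]].
  have [|c' h] := @power_series_on_cst 1 rho 1; first by rewrite normr1.
  exists c'; rewrite big_nil; apply: power_series_on_ext h => z _.
  by rewrite big_nil.
have [c2 h2] := power_series_on_exp (be i) rho0 (cF i).
have [c' h] := power_series_on_mul rho0 h2 IH.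
exists c'; rewrite big_cons; apply: power_series_on_ext h => z _.
by rewrite big_cons.
Qed.

Lemma power_series_on_le c F rho M N : M <= N ->
  power_series_on rho M c F -> power_series_on rho N c F.
Proof. by move=> MN [b s]; split=> //; exact: abs_bounded_le b. Qed.

Lemma power_series_on_bound c F rho M z : 0 <= rho -> power_series_on rho M c F ->
  (forall i, `|z 0 i| <= rho) -> `|F z| <= M.
Proof.
move=> rho0 [b s] zr; apply: has_sum_norm_le (s z zr).
apply: abs_bounded_le b => // al; rewrite !normrM ler_wpM2l//.
by rewrite normrX (ger0_norm rho0) norm_monomial_le.
Qed.

(** The norm bound of each inner series is the outer radius [sigma]. Hence the monomial [be] in the
    components of [F] has norm at most [sigma ^+ total_degree be], and the outer bound makes the
    total at most [M]. *)
Lemma power_series_on_comp cg G rho sigma M (c : 'I_n -> midx -> C)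
    (F : 'rV[C]_n -> 'rV[C]_n) :
  0 < rho -> power_series_on sigma M cg G ->
  (forall i, power_series_on rho sigma (c i) (fun z => F z 0 i)) ->
  0 <= sigma ->
  exists c', power_series_on rho M c' (G \o F).
Proof.
move=> rho0 [bg sg] cF sigma0.
have h be : exists c', power_series_on rho (`|cg be| * sigma ^+ total_degree be) c'
    (fun z => cg be * monomial be (F z)).
  have [c1 h1] := power_series_on_prod (index_enum 'I_n) be rho0 cF.
  have [c2 h2] := @power_series_on_cst (cg be) rho _ (lexx _).
  by have := power_series_on_mul rho0 h2 h1; rewrite prodrXr.
have [c' {}h] := choice h.
apply: (power_series_on_sum rho0 h).
  by apply: abs_bounded_le bg => // be; rewrite !normrM normr_id.
by move=> z zr; apply: sg => i; exact: power_series_on_bound (ltW rho0) (cF i) zr.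
Qed.

End PowerSeriesCalculus.

(** * Restriction to smaller polydiscs and Lipschitz bounds *)

Section Estimates.
Set Implicit Arguments.
Unset Strict Implicit.
Unset Printing Implicit Defensive.
Variables (R : realType) (n : nat).
Local Notation C := (Cplx R).
Local Notation midx := {ffun 'I_n -> nat}.
Implicit Types (al be : midx) (z w : 'rV[C]_n) (c : midx -> C) (rho M s : C).

Lemma has_power_series_on c (F : 'rV[C]_n -> C) : has_power_series 0 c F ->
  exists rho M, 0 < rho /\ power_series_on rho M c F.
Proof.
move=> /nbhs_ballP[e /= e0 eF].
have rhoe : e / 2 < e by rewrite gtr_pMr// invf_lt1// ltr1n.
have rho0 : 0 < e / 2 by rewrite divr_gt0.
have sF z : (forall i, `|z 0 i| <= e / 2) -> has_sum (fun al => c al * monomial al z) (F z).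
  move=> zr; have := eF z; rewrite subr0; apply; split=> // i j.
  by rewrite ord1 -ball_normE/= mxE sub0r normrN (le_lt_trans (zr j)).
(* Convergence at the single corner point, all of whose coordinates are [e / 2], bounds the series
   on the whole closed polydisc. *)
have [M hM] : exists M, abs_bounded (fun al => c al * (e / 2) ^+ total_degree al) M.
  have [|M hM] := has_sum_abs_bounded (sF (const_mx (e / 2)) _).
    by move=> i; rewrite mxE gtr0_norm.
  by exists M => A; have := hM A; under eq_bigr do rewrite monomial_const.
by exists (e / 2), M.
Qed.

Lemma power_series_on_has c (F : 'rV[C]_n -> C) rho M : 0 < rho ->
  power_series_on rho M c F -> has_power_series 0 c F.
Proof.
move=> rho0 [_ sF]; apply/nbhs_ballP; exists rho => // z [_ zr]; rewrite /= subr0.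
apply: sF => i; have := zr 0 i.
by rewrite -ball_normE/= mxE sub0r normrN => /ltW.
Qed.

Definition order_ge (e : nat) c := forall al, (total_degree al < e)%N -> c al = 0.

(** A term of degree k shrinks by the factor (s / rho)^k, which is at most (s / rho)^e once k >=
    e. *)
Lemma power_series_on_shrink c (F : 'rV[C]_n -> C) rho M e s :
  0 < s -> s <= rho -> order_ge e c -> power_series_on rho M c F ->
  power_series_on s (M * (s / rho) ^+ e) c F.
Proof.
move=> s0 sr ce [b sF]; split; last first.
  by move=> z zs; apply: sF => i; exact: le_trans sr.
have rho0 : 0 < rho by exact: lt_le_trans sr.
have q0 : 0 < s / rho by rewrite divr_gt0.
have q1 : s / rho <= 1 by rewrite ler_pdivrMr// mul1r.
move=> A; apply: le_trans (ler_wpM2r _ (b A)); last by rewrite exprn_ge0// ltW.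
rewrite mulr_suml; apply: ler_sum => al _.
have [/ce->|ale] := ltnP (total_degree al) e; first by rewrite !mul0r normr0 mul0r.
rewrite !normrM -mulrA ler_wpM2l// !normrX !gtr0_norm//.
rewrite -[s in leLHS](divfK (lt0r_neq0 rho0)) exprMn mulrC ler_wpM2l ?exprn_ge0 ?(ltW rho0)//.
by rewrite ler_wiXn2l// ltW.
Qed.

Lemma power_series_on_small c (F : 'rV[C]_n -> C) rho M s :
  0 < rho -> 0 < s -> order_ge 1 c -> power_series_on rho M c F ->
  exists2 rho', 0 < rho' & power_series_on rho' s c F.
Proof.
move=> rho0 s0 c1 cF; have M0 := abs_bounded_ge0 cF.1.
have sM : 0 < s + M by rewrite ltr_wpDr.
have q1 : s / (s + M) <= 1 by rewrite ler_pdivrMr// mul1r lerDl.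
(* Without constant term the norm shrinks at least linearly with the radius, and M s / (s + M) <= s.
   The denominator [s + M] is positive even if [M] is 0. *)
exists (rho * (s / (s + M))); first by rewrite mulr_gt0// divr_gt0.
apply: power_series_on_le; last first.
  apply: power_series_on_shrink c1 cF; first by rewrite mulr_gt0// divr_gt0.
  by rewrite ler_piMr// ltW.
rewrite expr1 [rho * _]mulrC mulfK ?gt_eqF//.
by rewrite mulrCA ler_piMr ?ler_pdivrMr// ?mul1r ?lerDr ltW.
Qed.

Lemma power_series_on_comb c1 c2 (F1 F2 : 'rV[C]_n -> C) rho M1 M2 k :
  power_series_on rho M1 c1 F1 -> power_series_on rho M2 c2 F2 ->
  power_series_on rho (M1 + `|k| * M2) (fun al => c1 al + k * c2 al)
    (fun z => F1 z + k * F2 z).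
Proof.
move=> [b1 s1] [b2 s2]; split=> [A|z zr].
  apply: le_trans (lerD (b1 A) (ler_wpM2l (normr_ge0 k) (b2 A))).
  rewrite mulr_sumr -big_split; apply: ler_sum => al _ /=.
  by rewrite -normrM mulrA mulrDl; exact: ler_normD.
have := has_sumD (s1 z zr) (has_sumZ (k := k) (s2 z zr)).
by congr (has_sum _ _); apply/funext => al; rewrite mulrDl mulrA.
Qed.

Lemma power_series_on_coord rho i : 0 < rho ->
  exists c, power_series_on rho rho c (fun z : 'rV[C]_n => z 0 i).
Proof.
move=> rho0; pose u : midx := [ffun j => (j == i : nat)].
have monu z : monomial u z = z 0 i.
  rewrite /monomial (bigD1 i)//= big1 => [|j /negbTE ji]; rewrite ffunE ?eqxx ?mulr1//.
  by rewrite ji.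
have degu : total_degree u = 1%N.
  rewrite /total_degree (bigD1 i)//= big1 => [|j /negbTE ji]; rewrite ffunE ?eqxx//.
  by rewrite ji.
exists (fun al => (al == u)%:R); split => [|z _].
  apply: (abs_bounded_single (i0 := u)) => [al /negbTE->|]; first by rewrite mul0r.
  by rewrite eqxx mul1r degu expr1 gtr0_norm.
have := @has_sum_single _ _ (fun al => (al == u)%:R * monomial al z) u.
by rewrite eqxx mul1r monu; apply=> al /negbTE->; rewrite mul0r.
Qed.

(** [|k| = 1] keeps [k *: z] in the same polydisc and bounds the factor [k - k ^+ total_degree al]
    by 2, hence [M + M]. *)
Lemma power_series_on_resonance c (G : 'rV[C]_n -> C) rho M k : `|k| = 1 ->
  power_series_on rho M c G ->
  power_series_on rho (M + M) (fun al => (k - k ^+ total_degree al) * c al)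
    (fun z => k * G z - G (k *: z)).
Proof.
move=> k1 [b sG]; split=> [A|z zr].
  apply: le_trans (lerD (b A) (b A)); rewrite -big_split; apply: ler_sum => al _ /=.
  rewrite -mulrA normrM -mulr2n -mulr_natl ler_wpM2r//.
  by apply: le_trans (ler_normB _ _) _; rewrite normrX k1 expr1n -natr1.
have kz i : `|(k *: z) 0 i| <= rho by rewrite mxE normrM k1 mul1r.
have := has_sumD (has_sumZ (k := k) (sG z zr)) (has_sumZ (k := -1) (sG _ kz)).
rewrite mulN1r; congr (has_sum _ _); apply/funext => al.
by rewrite monomialZ; ring.
Qed.

(* The factor [s] on the left avoids the exponent [total_degree al - 1], which
   would be truncated in degree [0]. *)
Lemma monomial_lipschitz al z w s t : 0 < s ->
  (forall i, `|z 0 i| <= s) -> (forall i, `|w 0 i| <= s) ->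
  (forall i, `|z 0 i - w 0 i| <= t) ->
  s * `|monomial al z - monomial al w| <= (total_degree al)%:R * s ^+ total_degree al * t.
Proof.
move=> s0 zs ws zw.
(* A discrete Leibniz rule, under which the degrees [k] and [l] add up. *)
have step (a a' b b' : C) k l : `|a'| <= s ^+ k -> `|b| <= s ^+ l ->
    s * `|a - a'| <= k%:R * s ^+ k * t -> s * `|b - b'| <= l%:R * s ^+ l * t ->
    s * `|a * b - a' * b'| <= (k + l)%:R * s ^+ (k + l) * t.
  move=> ha hb haa hbb.
  have -> : a * b - a' * b' = (a - a') * b + a' * (b - b') by ring.
  apply: (@le_trans _ _ (s * `|a - a'| * `|b| + `|a'| * (s * `|b - b'|))).
    rewrite mulrCA -mulrA -mulrDr ler_wpM2l ?(ltW s0)//.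
    by apply: le_trans (ler_normD _ _) _; rewrite !normrM.
  have -> : (k + l)%:R * s ^+ (k + l) * t =
     k%:R * s ^+ k * t * s ^+ l + s ^+ k * (l%:R * s ^+ l * t).
    by rewrite natrD exprD; ring.
  by rewrite lerD// ler_pM// mulr_ge0// ltW.
have pow (x y : C) k : `|x| <= s -> `|y| <= s -> `|x - y| <= t ->
    s * `|x ^+ k - y ^+ k| <= k%:R * s ^+ k * t.
  move=> xs ys xy; elim: k => [|k IH]; first by rewrite !expr0 subrr normr0 mulr0 !mul0r.
  rewrite (exprS x) (exprS y) -[k.+1]add1n; apply: step => //.
  - by rewrite normrX lerXn2r// nnegrE// ltW.
  - by rewrite mul1r expr1 ler_wpM2l// ltW.
have prodle (l : seq 'I_n) (x : 'rV[C]_n) : (forall i, `|x 0 i| <= s) ->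
    `|\prod_(i <- l) x 0 i ^+ al i| <= s ^+ (\sum_(i <- l) al i).
  move=> xs; rewrite normr_prod -prodrXr; apply: ler_prod => i _.
  by rewrite normrX exprn_ge0//= lerXn2r// nnegrE// ltW.
rewrite /monomial /total_degree; elim: (index_enum _) => [|i l IH].
  by rewrite !big_nil subrr normr0 mulr0 !mul0r.
rewrite !big_cons; apply: step => //.
- by rewrite normrX lerXn2r// nnegrE// ltW.
- exact: prodle.
- exact: pow.
Qed.

(** Termwise, [monomial_lipschitz] costs a factor |al|. It is absorbed by |al| <= 2^|al|, that is,
    by evaluating the series at radius [2 * s]; this explains [s <= rho / 2]. *)
Lemma power_series_on_lipschitz c (H : 'rV[C]_n -> C) rho M e z w s t :
  order_ge e c -> power_series_on rho M c H -> 0 < s -> s <= rho / 2 -> 0 <= t ->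
  (forall i, `|z 0 i| <= s) -> (forall i, `|w 0 i| <= s) ->
  (forall i, `|z 0 i - w 0 i| <= t) ->
  s * `|H z - H w| <= M * (2 * s / rho) ^+ e * t.
Proof.
move=> ce cH s0 sr t0 zs ws zw.
have rho0 : 0 < rho.
  by have := lt_le_trans s0 sr; rewrite pmulr_lgt0 ?invr_gt0.
have s20 : 0 < 2 * s by rewrite mulr_gt0.
have s2r : 2 * s <= rho by rewrite mulrC -ler_pdivlMr.
have srho : s <= rho by apply: le_trans s2r; rewrite ler_peMl ?ltW// ltr1n.
have [b _] := power_series_on_shrink s20 s2r ce cH.
rewrite -[X in X * `|_|](gtr0_norm s0) -normrM.
have hz := cH.2 z (fun i => le_trans (zs i) srho).
have hw := cH.2 w (fun i => le_trans (ws i) srho).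
apply: has_sum_norm_le; last first.
  by rewrite -(mulN1r (H w)); exact: has_sumZ (has_sumD hz (has_sumZ (k := -1) hw)).
move=> A; apply: le_trans (ler_wpM2r t0 (b A)); rewrite mulr_suml; apply: ler_sum => al _.
rewrite mulN1r -mulrBr mulrCA !normrM (gtr0_norm s0) -mulrA ler_wpM2l//.
apply: le_trans (monomial_lipschitz _ s0 zs ws zw) _; rewrite ler_wpM2r//.
rewrite normrX (gtr0_norm s20) exprMn ler_wpM2r ?exprn_ge0 ?(ltW s0)//.
by rewrite -natrX ler_nat ltnW// ltn_expl.
Qed.

End Estimates.

(** * Orders of vanishing at the origin *)

Section Landau.
Set Implicit Arguments.
Unset Strict Implicit.
Unset Printing Implicit Defensive.
Variables (R : realType) (n : nat).
Local Notation C := (Cplx R).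
Local Notation midx := {ffun 'I_n -> nat}.
Implicit Types (al be : midx) (z w : 'rV[C]_n) (c : midx -> C) (rho M s : C).

(* In the partial order of [C], [0 < s] forces [s] to be real. *)
Definition small : set_system C :=
  filter_from [set r | 0 < r] (fun r => [set s | 0 < s /\ s <= r]).

#[local] Instance small_filter : ProperFilter small.
Proof.
apply: filter_from_proper; last by move=> r /= r0; exists r.
apply: filter_from_filter; first by exists 1; rewrite /= ltr01.
(* A common lower bound of [a] and [b] built by field operations, with no comparison between
   them. *)
move=> a b /= a0 b0; have ab : 0 < a^-1 + b^-1 by rewrite addr_gt0 ?invr_gt0.
exists (a^-1 + b^-1)^-1; first by rewrite /= invr_gt0.
move=> s /= [s0 sab]; split; split=> //; apply: le_trans sab _.
  by rewrite -[leRHS]invrK lef_pV2 ?posrE ?invr_gt0// lerDl invr_ge0 ltW.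
by rewrite -[leRHS]invrK lef_pV2 ?posrE ?invr_gt0// lerDr invr_ge0 ltW.
Qed.

Lemma small_gt0 : \forall s \near small, 0 < s.
Proof. by exists 1 => [|s []]; rewrite /= ?ltr01. Qed.

Lemma small_le rho : 0 < rho -> \forall s \near small, s <= rho.
Proof. by move=> rho0; exists rho => // s []. Qed.

Lemma small_scale (P : set C) k : 0 < k -> small P -> \forall s \near small, P (k * s).
Proof.
move=> k0 [r /= r0 rP]; exists (r / k); first by rewrite /= divr_gt0.
by move=> s /= [s0 sr]; apply: rP; rewrite /= mulr_gt0// mulrC -ler_pdivlMr.
Qed.

(* [F z = O(|z|^e)] at the origin for [|z| = max_i |z_i|]. *)
Definition big_O (e : nat) (F : 'rV[C]_n -> C) : Prop :=
  exists2 k, 0 < k & \forall s \near small,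
    forall z, (forall i, `|z 0 i| <= s) -> `|F z| <= k * s ^+ e.

Lemma power_series_big_O c (F : 'rV[C]_n -> C) rho M e : 0 < rho ->
  order_ge e c -> power_series_on rho M c F -> big_O e F.
Proof.
move=> rho0 ce cF; have M0 := abs_bounded_ge0 cF.1.
have q0 : 0 <= M / rho ^+ e by rewrite divr_ge0// exprn_ge0// ltW.
exists (M / rho ^+ e + 1); first by rewrite ltr_wpDl.
near=> s => z zs; have s0 : 0 < s by near: s; exact: small_gt0.
have sr : s <= rho by near: s; exact: small_le.
have := power_series_on_bound (ltW s0) (power_series_on_shrink s0 sr ce cF) zs.
move=> /le_trans; apply; rewrite expr_div_n mulrA mulrAC ler_wpM2r ?lerDl//.
by rewrite exprn_ge0// ltW.
Unshelve. all: by end_near. Qed.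

Lemma big_O_coord i : big_O 1 (fun z => z 0 i).
Proof. by exists 1 => //; near=> s => z zs; rewrite mul1r expr1. Unshelve. all: by end_near. Qed.

Lemma big_O_ext e (F G : 'rV[C]_n -> C) : (forall z, F z = G z) -> big_O e F -> big_O e G.
Proof. by move=> /funext ->. Qed.

Lemma big_OD e (F G : 'rV[C]_n -> C) : big_O e F -> big_O e G -> big_O e (fun z => F z + G z).
Proof.
move=> [k k0 Fk] [l l0 Gl]; exists (k + l); first exact: addr_gt0.
near=> s => z zs; rewrite (le_trans (ler_normD _ _))// mulrDl lerD//.
  by move: z zs; near: s; exact: Fk.
by move: z zs; near: s; exact: Gl.
Unshelve. all: by end_near. Qed.

Lemma big_OZ e (F : 'rV[C]_n -> C) k : big_O e F -> big_O e (fun z => k * F z).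
Proof.
move=> [l l0 Fl]; exists ((`|k| + 1) * l); first by rewrite mulr_gt0// ltr_wpDl.
near=> s => z zs; have s0 : 0 < s by near: s; exact: small_gt0.
have h : `|F z| <= l * s ^+ e by move: z zs; near: s; exact: Fl.
rewrite normrM -mulrA mulrDl mul1r (le_trans (ler_wpM2l _ h))// lerDl.
by rewrite mulr_ge0 ?exprn_ge0// ltW.
Unshelve. all: by end_near. Qed.

Lemma big_O_weaken e e' (F : 'rV[C]_n -> C) : (e' <= e)%N -> big_O e F -> big_O e' F.
Proof.
move=> ee [k k0 Fk]; exists k => //.
near=> s => z zs; have s0 : 0 < s by near: s; exact: small_gt0.
have h : `|F z| <= k * s ^+ e by move: z zs; near: s; exact: Fk.
rewrite (le_trans h)// ler_wpM2l ?(ltW k0)// ler_wiXn2l// ?(ltW s0)//.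
by near: s; exact: small_le.
Unshelve. all: by end_near. Qed.

Lemma big_O_uniform (I : finType) e (F : I -> 'rV[C]_n -> C) : (forall i, big_O e (F i)) ->
  exists2 k, 0 < k & \forall s \near small,
    forall i z, (forall j, `|z 0 j| <= s) -> `|F i z| <= k * s ^+ e.
Proof.
move=> hF; have /choice[k hk] : forall i, exists k, 0 < k /\ \forall s \near small,
    forall z, (forall j, `|z 0 j| <= s) -> `|F i z| <= k * s ^+ e.
  by move=> i; have [k] := hF i; exists k.
have k0 i : 0 < k i := (hk i).1.
have Fk i := (hk i).2.
have ki i : k i <= 1 + \sum_i k i.
  rewrite (bigD1 i)//= addrCA lerDl addr_ge0// sumr_ge0// => j _; exact: ltW.
exists (1 + \sum_i k i).
  by rewrite ltr_pwDl// sumr_ge0// => i _; exact: ltW.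
have {}Fk := filter_forall _ Fk.
near=> s => i z zs; have s0 : 0 < s by near: s; exact: small_gt0.
apply: (@le_trans _ _ (k i * s ^+ e)).
  by move: i z zs; near: s; exact: Fk.
by rewrite ler_wpM2r// exprn_ge0// ltW.
Unshelve. all: by end_near. Qed.

Lemma big_O_comp e (G : 'rV[C]_n -> C) (F : 'rV[C]_n -> 'rV[C]_n) :
  big_O e G -> (forall i, big_O 1 (fun z => F z 0 i)) -> big_O e (G \o F).
Proof.
move=> [k k0 Gk] /big_O_uniform[l l0 Fl].
exists (k * l ^+ e); first by rewrite mulr_gt0// exprn_gt0.
have {}Gk := small_scale l0 Gk.
near=> s => z zs; rewrite -mulrA -exprMn /=.
have h : forall i, `|F z 0 i| <= l * s.
  by move=> i; rewrite -[s]expr1; move: i z zs; near: s; exact: Fl.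
by move: (F z) h; near: s; exact: Gk.
Unshelve. all: by end_near. Qed.

(** A mean value inequality: a series of order [e.+1] has Lipschitz constant O(s^e) on the polydisc
    of radius s. *)
Lemma big_O_lipschitz c (H : 'rV[C]_n -> C) rho M e k (F G : 'rV[C]_n -> 'rV[C]_n) :
  0 < rho -> order_ge e.+1 c -> power_series_on rho M c H ->
  (forall i, big_O 1 (fun z => F z 0 i)) -> (forall i, big_O 1 (fun z => G z 0 i)) ->
  (forall i, big_O k (fun z => F z 0 i - G z 0 i)) ->
  big_O (e + k) (fun z => H (F z) - H (G z)).
Proof.
move=> rho0 ce cH /big_O_uniform[a a0 Fa] /big_O_uniform[b b0 Gb] /big_O_uniform[d d0 FGd].
have M0 := abs_bounded_ge0 cH.1.
have ab0 : 0 < a + b by rewrite addr_gt0.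
(* Radius [(a + b) * s] contains the values of both maps. [K] is what remains of the Lipschitz bound
   at that radius, for distance [d * s ^+ k], after cancelling [(a + b) * s]. *)
pose K := M * (2 / rho) ^+ e.+1 * (a + b) ^+ e * d.
have K0 : 0 <= K.
  by rewrite /K !mulr_ge0// ?exprn_ge0// ?divr_ge0// ?(ltW rho0) ?(ltW ab0) ?(ltW d0).
exists (K + 1); first by rewrite ltr_wpDl.
near=> s => z zs; have s0 : 0 < s by near: s; exact: small_gt0.
have abs0 : 0 < (a + b) * s by rewrite mulr_gt0.
have sr : (a + b) * s <= rho / 2.
  near: s; apply: (small_scale (P := [set s | s <= rho / 2])) => //.
  by apply: small_le; rewrite divr_gt0.
have hF i : `|F z 0 i| <= (a + b) * s.
  apply: (@le_trans _ _ (a * s)); last by rewrite ler_wpM2r ?lerDl ?(ltW s0) ?(ltW b0).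
  by rewrite -[s]expr1; move: i z zs; near: s; exact: Fa.
have hG i : `|G z 0 i| <= (a + b) * s.
  apply: (@le_trans _ _ (b * s)); last by rewrite ler_wpM2r ?lerDr ?(ltW s0) ?(ltW a0).
  by rewrite -[s]expr1; clear hF; move: i z zs; near: s; exact: Gb.
have hFG i : `|F z 0 i - G z 0 i| <= d * s ^+ k.
  by clear hF hG; move: i z zs; near: s; exact: FGd.
have ds0 : 0 <= d * s ^+ k by rewrite mulr_ge0 ?exprn_ge0 ?(ltW d0) ?(ltW s0).
rewrite -(ler_pM2l abs0).
apply: le_trans (power_series_on_lipschitz ce cH abs0 sr ds0 hF hG hFG) _.
rewrite [leLHS](_ : _ = (a + b) * s * (K * s ^+ (e + k))); last first.
  by rewrite /K exprD !exprS !expr_div_n !exprMn; ring.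
by rewrite ler_wpM2l ?(ltW abs0)// ler_wpM2r ?lerDl// exprn_ge0// ltW.
Unshelve. all: by end_near. Qed.

End Landau.

#[local] Existing Instance small_filter.

(** * Recovering coefficients from growth *)

Section LeadingCoefficients.
Set Implicit Arguments.
Unset Strict Implicit.
Unset Printing Implicit Defensive.

Lemma base_digits_inj (N n : nat) (a b : nat -> nat) :
  (forall i, (i < n)%N -> (a i < N)%N) -> (forall i, (i < n)%N -> (b i < N)%N) ->
  (\sum_(i < n) a i * N ^ i = \sum_(i < n) b i * N ^ i)%N ->
  forall i, (i < n)%N -> a i = b i.
Proof.
elim: n a b => [//|n IH] a b aN bN.
have E (u : nat -> nat) : (\sum_(i < n.+1) u i * N ^ i =
    (\sum_(i < n) u i.+1 * N ^ i) * N + u 0)%N.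
  rewrite big_ord_recl expn0 muln1 addnC; congr addn; rewrite big_distrl.
  by apply: eq_bigr => i _; rewrite /= /bump leq0n add1n expnS mulnCA mulnC.
rewrite !E => ab.
have N0 : (0 < N)%N by rewrite (leq_ltn_trans _ (aN 0%N _)).
have /eqP a0 : a 0%N == b 0%N.
  by have := congr1 (modn^~ N) ab; rewrite /= !modnMDl !modn_small ?aN ?bN// => ->.
move: ab; rewrite a0 => /addIn/eqP; rewrite eqn_pmul2r// => /eqP ab [_|i]; first by [].
by apply: (IH (fun k => a k.+1) (fun k => b k.+1)) ab i => k kn; [apply: aN|apply: bN].
Qed.

Variables (R : realType) (n : nat).
Local Notation C := (Cplx R).
Local Notation midx := {ffun 'I_n -> nat}.
Implicit Types (al be : midx) (z w : 'rV[C]_n) (c : midx -> C) (rho M s : C).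

Lemma total_degree_ge al i : (al i <= total_degree al)%N.
Proof. by rewrite /total_degree (bigD1 i)//= leq_addr. Qed.

Lemma exists_degree_fset d : exists A : {fset midx}, forall al,
  (al \in A) = (total_degree al == d).
Proof.
pose g (b : {ffun 'I_n -> 'I_d.+1}) : midx := [ffun i => b i : nat].
exists [fset al in [seq g b | b <- enum {ffun 'I_n -> 'I_d.+1}] | total_degree al == d]%fset.
move=> al; rewrite !inE/=; apply/andP/idP => [[]//|ald]; split=> //.
apply/mapP; exists [ffun i => inord (al i)]; first by rewrite mem_enum.
apply/ffunP => i; rewrite !ffunE inordK// ltnS -(eqP ald); exact: total_degree_ge.
Qed.

(* Kronecker substitution [z_i = x ^ ((d+1) ^ i)] sends the monomials of degree
   [d] to distinct powers of [x]. *)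
Lemma homogeneous_eq0 d (A : {fset midx}) c : (forall al, al \in A -> total_degree al = d) ->
  (forall z, (forall i, `|z 0 i| <= 1) -> \sum_(al <- A) c al * monomial al z = 0) ->
  forall al, al \in A -> c al = 0.
Proof.
move=> Ad PA al0 al0A; pose N := d.+1.
pose e al := (\sum_(i < n) al i * N ^ i)%N.
pose p : {poly C} := \sum_(al <- A) c al *: 'X^(e al).
have px x : `|x| <= 1 -> p.[x] = 0.
  move=> x1; pose z : 'rV[C]_n := \row_i x ^+ (N ^ i).
  rewrite -(PA z) => [|i]; last by rewrite mxE normrX exprn_ile1.
  rewrite horner_sum; apply: eq_bigr => al _; rewrite hornerZ hornerXn; congr (_ * _).
  by rewrite /monomial /e -prodrXr; apply: eq_bigr => i _; rewrite mxE -exprM mulnC.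
have p0 : p = 0.
  (* The numbers 1 / (k + 1) with k < [size p] are distinct roots in the closed unit disc, too many
     for a nonzero [p]. *)
  apply: (@roots_geq_poly_eq0 _ p [seq (k.+1)%:R^-1 | k <- iota 0 (size p)]).
  - apply/allP => x /mapP[k _ ->]; apply/rootP/px.
    by rewrite ger0_norm ?invr_ge0// invf_le1// ler1n.
  - rewrite map_inj_uniq ?iota_uniq// => j k /invr_inj/eqP.
    by rewrite eqr_nat eqSS => /eqP.
  - by rewrite size_map size_iota.
have eN al : al \in A -> forall i, (al i < N)%N.
  by move=> alA i; rewrite /N ltnS -(Ad _ alA) total_degree_ge.
have e_inj : {in A &, injective e}.
  (* [u] extends a multi-index by 0 to all naturals, the form in which [base_digits_inj] takes
     digits. *)
  move=> al be alA beA; pose u (ga : midx) k := oapp ga 0%N (insub k).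
  have uE ga (i : 'I_n) : u ga i = ga i by rewrite /u valK.
  have uN ga k : ga \in A -> (k < n)%N -> (u ga k < N)%N.
    by move=> gaA kn; rewrite (uE ga (Ordinal kn)) eN.
  have eE ga : e ga = (\sum_(i < n) u ga i * N ^ i)%N.
    by apply: eq_bigr => i _; rewrite uE.
  rewrite !eE => /base_digits_inj ab; apply/ffunP => i.
  by rewrite -!uE ab// => k; exact: uN.
have := congr1 (fun q : {poly C} => q`_(e al0)) p0.
rewrite coef0 coef_sum (big_fsetD1 al0)//= coefZ coefXn eqxx mulr1 big1_fset ?addr0//.
move=> al; rewrite !inE => /andP[ne alA] _; rewrite coefZ coefXn.
case: eqP => [/esym/e_inj E|_]; last by rewrite mulr0.
by rewrite (E alA al0A) eqxx in ne.
Qed.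

(** The homogeneous part [P] of degree [d] differs from [H] by a series of order [d.+1], so it is
    itself O(|z|^(d+1)). By homogeneity |P(z)| <= k s on the unit polydisc for all small s, so [P]
    vanishes there. *)
Lemma monomial_order_ge c (H : 'rV[C]_n -> C) rho M d : 0 < rho ->
  order_ge d c -> power_series_on rho M c H -> big_O d.+1 H -> order_ge d.+1 c.
Proof.
move=> rho0 cd cH HO; have [A hA] := exists_degree_fset d.
pose P z := \sum_(al <- A) c al * monomial al z.
have PO : big_O d.+1 P.
  pose c' al := if al \in A then 0 else c al.
  have cc' : order_ge d.+1 c'.
    move=> al; rewrite ltnS leq_eqVlt /c' hA => /orP[->//|ald].
    by case: ifP => // _; exact: cd.
  have c'HP : power_series_on rho M c' (fun z => H z - P z).
    split.
      apply: abs_bounded_le cH.1 => // al; rewrite /c'; case: ifP => // _.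
      by rewrite mul0r normr0.
    move=> z zr.
    pose y al := if al \in A then c al * monomial al z else 0.
    have hy : has_sum y (P z).
      rewrite /P [X in has_sum _ X](_ : _ = \sum_(al <- A) y al).
        by apply: has_sum_finite => al; rewrite /y => /negbTE->.
      by apply: eq_fbigr => al alA _; rewrite /y alA.
    have := has_sumD (cH.2 z zr) (has_sumZ (k := -1) hy).
    rewrite mulN1r; congr (has_sum _ _); apply/funext => al.
    by rewrite /c' /y; case: ifP => _; ring.
  have := big_OD HO (big_OZ (-1) (power_series_big_O rho0 cc' c'HP)).
  by apply: big_O_ext => z; ring.
have PZ t z : P (t *: z) = t ^+ d * P z.
  rewrite /P mulr_sumr; apply: eq_fbigr => al; rewrite hA => /eqP ald _.
  by rewrite monomialZ ald mulrCA.
have P0 z : (forall i, `|z 0 i| <= 1) -> P z = 0.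
  move=> z1; apply/eqP; rewrite -normr_le0; apply/ler_addgt0Pr => e e0.
  have [k k0 Pk] := PO.
  near (@small R) => s; have s0 : 0 < s by near: s; exact: small_gt0.
  have : `|P (s *: z)| <= k * s ^+ d.+1.
    have : forall i, `|(s *: z) 0 i| <= s.
      by move=> i; rewrite mxE normrM (gtr0_norm s0) ler_piMr// ltW.
    by move: (s *: z); near: s; exact: Pk.
  rewrite PZ normrM normrX (gtr0_norm s0) exprSr mulrCA ler_pM2l ?exprn_gt0//.
  rewrite add0r => /le_trans; apply.
  rewrite mulrC -ler_pdivlMr//; near: s; apply: small_le; rewrite divr_gt0//.
move=> al; rewrite ltnS leq_eqVlt => /orP[ald|]; last exact: cd.
apply: (homogeneous_eq0 (d := d) (A := A)) => [be|z|].
- by rewrite hA => /eqP.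
- exact: P0.
- by rewrite hA.
Unshelve. all: by end_near. Qed.

End LeadingCoefficients.

(** * The iterates *)

Section Iterates.
Set Implicit Arguments.
Unset Strict Implicit.
Unset Printing Implicit Defensive.
Variables (R : realType) (n : nat).
Local Notation C := (Cplx R).
Local Notation midx := {ffun 'I_n -> nat}.
Variables (f : 'rV[C]_n -> 'rV[C]_n) (lambda : C).
Hypothesis f_power_series : forall i, exists c rho M,
  [/\ order_ge 2 c, 0 < rho & power_series_on rho M c (fun z => f z 0 i - lambda * z 0 i)].

Lemma big_O2_f i : big_O 2 (fun z => f z 0 i - lambda * z 0 i).
Proof.
have [c [rho [M [c2 rho0 cf]]]] := f_power_series i.
exact: power_series_big_O cf.
Qed.

Lemma big_O1_linear_perturbation (F : 'rV[C]_n -> 'rV[C]_n) k i :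
  big_O 2 (fun z => F z 0 i - k * z 0 i) -> big_O 1 (fun z => F z 0 i).
Proof.
move=> /(@big_O_weaken _ _ 2 1 _ isT) Fk.
have := big_OD Fk (big_OZ k (big_O_coord R i)).
by apply: big_O_ext => z; rewrite subrK.
Qed.

Lemma big_O2_iter k i : big_O 2 (fun z => iter k f z 0 i - lambda ^+ k * z 0 i).
Proof.
elim: k i => [|k IH] i.
  (* For k = 0 the difference is zero, presented as 0 times a function already known to be
     O(|z|^2). *)
  apply: (@big_O_ext _ _ _ (fun z => 0 * (f z 0 i - lambda * z 0 i))); last first.
    exact: big_OZ (big_O2_f i).
  by move=> z; rewrite mul0r /= mul1r subrr.
have IH1 j : big_O 1 (fun z => iter k f z 0 j) := big_O1_linear_perturbation (IH j).
have := big_OD (big_O_comp (big_O2_f i) IH1) (big_OZ lambda (IH i)).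
by apply: big_O_ext => z; rewrite /= exprS; ring.
Qed.

Lemma big_O1_iter k i : big_O 1 (fun z => iter k f z 0 i).
Proof. exact: big_O1_linear_perturbation (big_O2_iter k i). Qed.

(** Composition needs inner norms below the outer radius, so the norm must be as small as
    prescribed; this is possible because [f] has no constant term. *)
Lemma power_series_on_f i s : 0 < s ->
  exists2 rho, 0 < rho & exists c, power_series_on rho s c (fun z => f z 0 i).
Proof.
move=> s0; have [ch [rho [M [_ rho0 cf]]]] := f_power_series i.
have [ci hi] := power_series_on_coord i rho0.
have := power_series_on_comb lambda cf hi.
set c := (fun al => _); set N := M + _ => cfi.
have {}cfi : power_series_on rho N c (fun z => f z 0 i).
  by apply: power_series_on_ext cfi => z _; rewrite subrK.
have c1 : order_ge 1 c.
  by apply: monomial_order_ge cfi _ => //; exact: (big_O1_iter 1).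
by have [r r0 cr] := power_series_on_small rho0 s0 c1 cfi; exists r => //; exists c.
Qed.

(** Induction with [s] free: the next iterate puts [f] outside, and the radius [t] on which [f] has
    norm [s] becomes the norm prescribed for the previous iterate. *)
Lemma power_series_on_iter k s : 0 < s ->
  exists2 rho, 0 < rho &
    forall i, exists c, power_series_on rho s c (fun z => iter k f z 0 i).
Proof.
elim: k s => [|k IH] s s0.
  by exists s => // i; exact: power_series_on_coord s0.
have /choice[r hr] : forall i, exists rho,
    0 < rho /\ exists c, power_series_on rho s c (fun z => f z 0 i).
  by move=> i; have [rho rho0 h] := power_series_on_f i s0; exists rho.
have [t t0 tr] : exists2 t, 0 < t & forall i, t <= r i.
  have [t [t0 tr]] : exists t, 0 < t /\ forall i, t <= r i.
    apply: (@filter_ex _ (@small R) (small_filter R)); apply: filterI; first exact: small_gt0.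
    exact: (filter_forall _ (fun i => small_le (hr i).1)).
  by exists t.
have [rho rho0 /choice[c hc]] := IH t t0; exists rho => // i.
have [cf hf] := (hr i).2.
(* With [e := 0] this is plain restriction to radius [t], with the norm bound unchanged. *)
have := power_series_on_shrink (e := 0) t0 (tr i) _ hf.
rewrite expr0 mulr1 => /(_ _)[//|b sf].
exact: power_series_on_comp rho0 (conj b sf) hc (ltW t0).
Qed.

Lemma resonance_big_O (F : 'rV[C]_n -> 'rV[C]_n) (cG : 'I_n -> midx -> C)
    (rho M : 'I_n -> C) d i :
  (forall z, f (F z) = F (f z)) ->
  (forall j, 0 < rho j) -> (forall j, order_ge d.+1 (cG j)) ->
  (forall j, power_series_on (rho j) (M j) (cG j) (fun z => F z 0 j - z 0 j)) ->
  (forall j, big_O 1 (fun z => F z 0 j)) ->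
  big_O d.+2 (fun z => lambda * (F z 0 i - z 0 i) -
                       (F (lambda *: z) 0 i - (lambda *: z) 0 i)).
Proof.
move=> fF rho0 cGd cG_F F1.
have [ch [rhoh [Mh [ch2 rhoh0 ch_f]]]] := f_power_series i.
have id1 j : big_O 1 (fun z : 'rV[C]_n => (id z) 0 j) := big_O_coord R j.
have lin1 j : big_O 1 (fun z : 'rV[C]_n => (lambda *: z) 0 j).
  by apply: big_O_ext (big_OZ lambda (id1 j)) => z; rewrite mxE.
have GO j : big_O d.+1 (fun z => id z 0 j - F z 0 j).
  have := big_OZ (-1) (power_series_big_O (rho0 j) (cGd j) (cG_F j)).
  by apply: big_O_ext => z; ring.
have f1 := big_O1_iter 1.
have fl2 j : big_O 2 (fun z => f z 0 j - (lambda *: z) 0 j).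
  by apply: big_O_ext (big_O2_f j) => z; rewrite mxE.
(* Orders: the first difference gets 1 from f - lambda id and [d.+1] from F - id; the second gets
   [d] from F - id and 2 from f - lambda id. *)
have A := big_O_lipschitz rhoh0 ch2 ch_f id1 F1 GO.
have B := big_O_lipschitz (rho0 i) (cGd i) (cG_F i) f1 lin1 fl2.
rewrite add1n in A; rewrite addn2 in B.
apply: big_O_ext (big_OD A B) => z /=.
by rewrite fF mxE; ring.
Qed.

Lemma iter_order_ge m : m.-primitive_root lambda -> forall i, exists c rho M,
  [/\ order_ge m.+1 c, 0 < rho &
      power_series_on rho M c (fun z => iter m f z 0 i - z 0 i)].
Proof.
move=> lm; have m0 := prim_order_gt0 lm.
have l1 : `|lambda| = 1.
  by apply/eqP; rewrite -(@pexpr_eq1 _ _ m)// -normrX prim_expr_order// normr1.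
have [rho rho0 hF] := power_series_on_iter m (@ltr01 C).
have /choice[c hc] : forall i, exists c,
    power_series_on rho (1 + `|-1| * rho) c (fun z => iter m f z 0 i - z 0 i).
  move=> i; have [c1 h1] := hF i; have [c2 h2] := power_series_on_coord i rho0.
  have := power_series_on_comb (-1) h1 h2; set c := (fun al => _) => h.
  by exists c; apply: power_series_on_ext h => z _; rewrite mulN1r.
have ff z : f (iter m f z) = iter m f (f z) by rewrite -iterS iterSr.
have F1 := big_O1_iter m.
have step d : (d < m)%N -> (forall i, order_ge d.+1 (c i)) ->
    forall i, order_ge d.+2 (c i).
  move=> dm cd i.
  (* Degree 1, where the resonance factor is zero, is settled by the linear part [lambda ^+ m = 1]
     of the iterate. *)
  case: d dm cd => [|d] dm cd.
    apply: (monomial_order_ge rho0 (cd i) (hc i)).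
    by apply: big_O_ext (big_O2_iter m i) => z; rewrite prim_expr_order// mul1r.
  have res : order_ge d.+3 (fun al => (lambda - lambda ^+ total_degree al) * c i al).
    apply: (monomial_order_ge rho0 _ (power_series_on_resonance l1 (hc i))).
      by move=> al ald; rewrite (cd i)// mulr0.
    exact: (resonance_big_O i ff (fun=> rho0) cd hc F1).
  move=> al; rewrite ltnS leq_eqVlt => /orP[/eqP ald|]; last exact: cd.
  apply/eqP; have := res al; rewrite ald ltnS leqnn => /(_ isT)/eqP.
  rewrite mulf_eq0 => /orP[|//].
  (* A zero factor would make [m] divide [d.+1], whereas 0 < d + 1 < m. *)
  rewrite -[X in X - _]expr1 subr_eq0 (eq_prim_root_expr lm) eq_sym.
  by rewrite -[d.+2]addn1 -[X in _ == X %[mod _]]add0n eqn_modDr mod0n modn_small.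
have c1 i : order_ge 1 (c i).
  apply: (monomial_order_ge rho0 _ (hc i)) => //.
  apply: (@big_O_weaken _ _ 2) => //.
  by apply: big_O_ext (big_O2_iter m i) => z; rewrite prim_expr_order// mul1r.
have {}step d : (d <= m)%N -> forall i, order_ge d.+1 (c i).
  by elim: d => [//|d IH] dm; apply: step => //; exact: IH (ltnW dm).
by move=> i; exists (c i), rho, (1 + `|-1| * rho); split=> //; exact: step.
Qed.

Lemma iter_in_eball (r : R) k : 0 < r ->
  \forall z \near (0 : 'rV[C]_n), eball r (iter k f z).
Proof.
move=> r0; pose e : C := ((r ^+ 2)%:C)%C.
have e0 : 0 < e by rewrite /e ltcR exprn_gt0.
have [K K0 FK] := big_O_uniform (big_O1_iter k).
have [s [s0 [Fs sS]]] : exists s : C, 0 < s /\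
    (forall (i : 'I_n) (z : 'rV[C]_n), (forall j, `|z 0 j| <= s) ->
       `|iter k f z 0 i| <= K * s ^+ 1) /\
    n%:R * (K * s) ^+ 2 < e.
  apply: (@filter_ex _ (@small R) (small_filter R)); apply: filterI; first exact: small_gt0.
  apply: filterI; first exact: FK.
  (* Passing from the polydisc to the Euclidean ball costs the factor [n]. For s <= 1 and s <= e /
     D, n K^2 s^2 <= n K^2 s < D s <= e, where the 1 in [D] gives strictness. *)
  pose D := n%:R * K ^+ 2 + 1.
  have D0 : 0 < D by rewrite /D ltr_wpDl// mulr_ge0// exprn_ge0// ltW.
  near=> s.
  have s0 : 0 < s by near: s; exact: small_gt0.
  have s1 : s <= 1 by near: s; exact: small_le.
  have se : s <= e / D by near: s; apply: small_le; rewrite divr_gt0.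
  rewrite exprMn mulrA (@lt_le_trans _ _ (D * s))//; last first.
    by rewrite mulrC -ler_pdivlMr.
  rewrite (@le_lt_trans _ _ (n%:R * K ^+ 2 * s))//.
    rewrite ler_wpM2l ?mulr_ge0 ?exprn_ge0 ?(ltW K0)//.
    by rewrite expr2 ler_piMr// ltW.
  by rewrite ltr_pM2r// /D ltrDl.
apply/nbhs_ballP; exists s => // z [_ zs] /=; apply: le_lt_trans sS.
rewrite -[n in leRHS]card_ord mulr_natl -sumr_const; apply: ler_sum => i _.
rewrite lerXn2r ?nnegrE// ?mulr_ge0 ?(ltW K0) ?(ltW s0)// -[s]expr1; apply: Fs => j.
by have := zs 0 j; rewrite -ball_normE/= mxE sub0r normrN => /ltW.
Unshelve. all: by end_near. Qed.

End Iterates.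

(** The first conjunct makes the iterate meaningful: near the origin, every point to which [f] is
    applied in forming [iter m f z] lies in the given ball. *)
Theorem proposition1 (R : realType) (n m : nat) (hn : (1 <= n)%N)
    (hm : (1 <= m)%N) (r : R) (hr : 0 < r) (lambda : Cplx R)
    (hlambda : m.-primitive_root lambda)
    (f : 'rV[Cplx R]_n -> 'rV[Cplx R]_n)
    (hol : holomorphic (@eball R n r) f)
    (hf : is_o_norm_pow 1 (fun z => f z - lambda *: z)) :
  (\forall z \near (0 : 'rV[Cplx R]_n),
     forall k : nat, (k < m)%N -> eball r (iter k f z)) /\
  is_o_norm_pow m (fun z => iter m f z - z).
Proof.
have f_series i : exists c rho M, [/\ order_ge 2 c, 0 < rho &
    power_series_on rho M c (fun z => f z 0 i - lambda * z 0 i)].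
  have [c [c1 /has_power_series_on[rho [M [rho0 cf]]]]] := hf i.
  exists c, rho, M; split; [exact: c1 | exact: rho0 |].
  by apply: power_series_on_ext cf => z _; rewrite !mxE.
split.
  have h := filter_forall _ (fun k : 'I_m => iter_in_eball f_series k hr).
  near=> z; have hz : forall k : 'I_m, eball r (iter k f z)
    by near: z; exact: h.
  by move=> k km; exact: (hz (Ordinal km)).
move=> i; have [c [rho [M [cm rho0 cF]]]] := iter_order_ge f_series hlambda i.
exists c; split; first by move=> al; exact: cm.
apply: (power_series_on_has rho0); apply: power_series_on_ext cF => z _.
by rewrite !mxE.
Unshelve. all: by end_near. Qed.
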